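(* Let $\mathfrak{g}_0$ be a compact semisimple real Lie algebra with compact Chevalley basis $\mathfrak{C}_0$, and let $U$ be a finite dimensional real $\mathfrak{g}_0$-module. Let $\mathfrak{B}_0$ be any basis of $U$ such that the elements of $\mathfrak{C}_0$ leave invariant $\mathbb{Q}\text{-span}(\mathfrak{B}_0)$. Let $\langle\,,\rangle$ be an inner product on $\mathfrak{n}_0=U\oplus\mathfrak{g}_0$ satisfying conditions (i), (ii), (iii) of the context and such that $\langle\xi,\xi'\rangle\in\mathbb{Q}$ for all $\xi,\xi'\in\mathfrak{B}_0\cup\mathfrak{C}_0$, and give $\mathfrak{n}_0$ the corresponding 2-step nilpotent Lie algebra structure. Then 1) $\mathfrak{L}_0=\mathfrak{B}_0\cup\mathfrak{C}_0$ is a basis of $\mathfrak{n}_0=U\oplus\mathfrak{g}_0$ that has rational structure constants. Furthermore, $\mathfrak{B}_0$ may be chosen so that $\mathfrak{L}_0$ is an orthogonal basis of $\{\mathfrak{n}_0,\langle\,,\rangle\}$. 2) The weight spaces $U_0$ and $U_\lambda$, $\lambda\in\Lambda^+$, are rational with respect to the rational structure $\mathfrak{n}_{0,\mathbb{Q}}=\mathbb{Q}\text{-span}(\mathfrak{L}_0)$; that is, each of them has an $\mathbb{R}$-basis contained in $\mathfrak{n}_{0,\mathbb{Q}}$.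
   Context: Conditions on $\langle\,,\rangle$: (i) $U\perp\mathfrak{g}_0$; (ii) every $X\in\mathfrak{g}_0$ acts skew symmetrically on $U$; (iii) $\mathrm{ad}X:\mathfrak{g}_0\to\mathfrak{g}_0$ is skew symmetric for every $X\in\mathfrak{g}_0$. The corresponding bracket on $\mathfrak{n}_0$: $\mathfrak{g}_0$ is central, $[\mathfrak{n}_0,\mathfrak{n}_0]\subseteq\mathfrak{g}_0$, and $\langle[u,u'],Z\rangle=\langle Z(u),u'\rangle$ for $u,u'\in U$, $Z\in\mathfrak{g}_0$. Compact Chevalley basis: let $\mathfrak{h}_0$ be a maximal abelian subalgebra of $\mathfrak{g}_0$, $\mathfrak{h}=\mathfrak{h}_0^{\mathbb{C}}$ the Cartan subalgebra of $\mathfrak{g}=\mathfrak{g}_0^{\mathbb{C}}$, with roots $\Phi$, base $\Delta$, positive roots $\Phi^+$, root spaces $\mathfrak{g}_\beta$, and $\tau_\alpha=2H_\alpha/B(H_\alpha,H_\alpha)$, where $B$ is the Killing form of $\mathfrak{g}$ and $H_\alpha\in\mathfrak{h}$ satisfies $B(H,H_\alpha)=\alpha(H)$ for all $H\in\mathfrak{h}$. A Chevalley basis of $\mathfrak{g}$ is a basis $\{X_\beta:\beta\in\Phi;\ \tau_\alpha:\alpha\in\Delta\}$ with $X_\beta\in\mathfrak{g}_\beta$, $[X_\alpha,X_{-\alpha}]=\tau_\alpha$ for all $\alpha\in\Phi$, and $[X_\alpha,X_\beta]=C_{\alpha,\beta}X_{\alpha+\beta}$ with $C_{\alpha,\beta}=-C_{-\alpha,-\beta}$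 whenever $\alpha,\beta,\alpha+\beta\in\Phi$. Then $\mathfrak{C}_0=\{\tilde\tau_\alpha=i\tau_\alpha:\alpha\in\Delta;\ A_\beta=X_\beta-X_{-\beta},\ B_\beta=iX_\beta+iX_{-\beta}:\beta\in\Phi^+\}$, where the Chevalley basis is such that $\mathbb{R}\text{-span}(\mathfrak{C}_0)=\mathfrak{g}_0$ and $\mathbb{R}\text{-span}\{\tilde\tau_\alpha:\alpha\in\Delta\}=\mathfrak{h}_0$. Weight spaces: $V=U^{\mathbb{C}}$, $\Lambda$ is the set of nonzero weights of $V$ relative to $\mathfrak{h}$, $V_\lambda=\{v\in V:Hv=\lambda(H)v\ \forall H\in\mathfrak{h}\}$, $V_0$ is the zero weight space, $U_\lambda=(V_\lambda\oplus V_{-\lambda})\cap U$, $U_0=V_0\cap U$, and $\Lambda^+$ contains exactly one of each pair $\lambda,-\lambda$ in $\Lambda$. A rational structure on a real Lie algebra is the $\mathbb{Q}$-span of a basis with rational structure constants.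
   Formalization: The claim that L0 can be made orthogonal fails (e.g. su(3), minus the Killing form): the fixed elements τ̃_α, τ̃_β of C0 for adjacent simple roots are never orthogonal. Orthogonality of L0 is stated and proved for all other pairs of distinct elements. *)

(* Defs.v *)
From HB Require Import structures.
From mathcomp Require Export all_boot all_order all_algebra.
From mathcomp Require Export boolp classical_sets reals.
From mathcomp Require Export complex.
From mathcomp Require Import ring.

Set Implicit Arguments.
Unset Strict Implicit.
Unset Printing Implicit Defensive.

Import Order.TTheory GRing.Theory Num.Theory.
Import VectorInternalTheory.

Local Open Scope classical_set_scope.
Local Open Scope ring_scope.

Section LieAlgebra.
Variables (F : fieldType) (L : vectType F).
Implicit Type br : {bilinear L -> L -> L}.

Definition lie_bracket br : Prop :=
  (forall x, br x x = 0) /\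
  (forall x y z, br x (br y z) + br y (br z x) + br z (br x y) = 0).

Definition killing_form br (x y : L) : F :=
  \tr (passmx.mxof (vbasis fullv) (vbasis fullv)
         (linfun (br x) \o linfun (br y))%VF).

Definition ideal br (I : {vspace L}) : Prop :=
  forall x y, y \in I -> br x y \in I.

Definition abelian_subspace br (A : {vspace L}) : Prop :=
  forall x y, x \in A -> y \in A -> br x y = 0.

Definition semisimple br : Prop :=
  forall I : {vspace L}, ideal br I -> abelian_subspace br I -> I = 0%VS.

Definition maximal_abelian br (A : {vspace L}) : Prop :=
  abelian_subspace br A /\
  forall A' : {vspace L},
    abelian_subspace br A' -> (A <= A')%VS -> A' = A.

Definition lie_module (U : vectType F) br
    (act : {bilinear L -> U -> U}) : Prop :=
  forall x y u, act (br x y) u = act x (act y u) - act y (act x u).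

End LieAlgebra.

(* For semisimple algebras, compact means negative definite Killing form. *)
Definition compact_semisimple (R : realType) (L : vectType R)
    (br : {bilinear L -> L -> L}) : Prop :=
  semisimple br /\ forall x, x != 0 -> killing_form br x x < 0.

(* [Cplx x y] stands for x + iy. *)
Record complexification (R : realType) (E : vectType R) :=
  Cplx { creal : E; cimag : E }.

Definition cinj (R : realType) (E : vectType R) (x : E) : complexification E :=
  Cplx x 0.

Section Complexification.
Variables (R : realType) (E : vectType R).
Notation EC := (complexification E).

Definition pair_of_cplx (z : EC) : E * E := (creal z, cimag z).
Definition cplx_of_pair (p : E * E) : EC := Cplx p.1 p.2.
Lemma pair_of_cplxK : cancel pair_of_cplx cplx_of_pair.
Proof. by case. Qed.

HB.instance Definition _ := Choice.copy EC (can_type pair_of_cplxK).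

Definition addcp (z w : EC) : EC :=
  Cplx (creal z + creal w) (cimag z + cimag w).
Definition oppcp (z : EC) : EC := Cplx (- creal z) (- cimag z).
Definition scalecp (a : R[i]) (z : EC) : EC :=
  Cplx (complex.Re a *: creal z - complex.Im a *: cimag z)
       (complex.Re a *: cimag z + complex.Im a *: creal z).

Lemma addcpA : associative addcp.
Proof. by move=> [a b] [c d] [e f]; rewrite /addcp /= !addrA. Qed.
Lemma addcpC : commutative addcp.
Proof. by move=> [a b] [c d]; congr Cplx; rewrite /= addrC. Qed.
Lemma add0cp : left_id (Cplx 0 0) addcp.
Proof. by move=> [a b]; rewrite /addcp /= !add0r. Qed.
Lemma addNcp : left_inverse (Cplx 0 0) oppcp addcp.
Proof. by move=> [a b]; rewrite /addcp /= !addNr. Qed.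

HB.instance Definition _ :=
  GRing.isZmodule.Build EC addcpA addcpC add0cp addNcp.


Lemma scalecpA a b z : scalecp a (scalecp b z) = scalecp (a * b) z.
Proof.
case: a b => [a a'] [b b']; congr Cplx; apply: v2r_inj; apply/rowP=> i;
  rewrite /= !(linearB, linearD, linearZ) !mxE /=; ring.
Qed.
Lemma scale1cp : left_id 1 scalecp.
Proof.
by case=> x y; congr Cplx; rewrite /= !scale1r scale0r ?subr0 ?addr0.
Qed.
Lemma scalecpDr : right_distributive scalecp +%R.
Proof.
move=> [a a'] z w; congr Cplx; apply: v2r_inj; apply/rowP=> i;
  rewrite /= !(linearB, linearD, linearZ) !mxE /=; ring.
Qed.
Lemma scalecpDl z : {morph scalecp^~ z : a b / a + b}.
Proof.
move=> [a a'] [b b']; congr Cplx; apply: v2r_inj; apply/rowP=> i;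
  rewrite /= !(linearB, linearD, linearZ) !mxE /=; ring.
Qed.

HB.instance Definition _ :=
  GRing.Zmodule_isLmodule.Build R[i] EC scalecpA scale1cp scalecpDr scalecpDl.

Fact cplx_vect_iso : Vector.axiom (dim E) EC.
Proof.
pose f (z : EC) := \row_i Complex (v2r (creal z) 0 i) (v2r (cimag z) 0 i).
exists f.
  move=> [a b] z w; apply/rowP=> i; rewrite !mxE /=.
  by rewrite !(linearB, linearD, linearZ) !mxE; simpc.
pose g (v : 'rV[R[i]]_(dim E)) : EC :=
  Cplx (r2v (map_mx (@complex.Re R) v)) (r2v (map_mx (@complex.Im R) v)).
exists g => [[x y]|v].
  by congr Cplx; apply: (canLR v2rK); apply/rowP=> i; rewrite !mxE.
by apply/rowP=> i; rewrite !mxE !r2vK !mxE; case: (v 0 i).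
Qed.
HB.instance Definition _ := Lmodule_hasFinDim.Build R[i] EC cplx_vect_iso.

(* A^C = A + iA *)
Definition complexify_vspace (A : {vspace E}) : {vspace EC} :=
  <<[seq cinj x | x <- vbasis A]>>%VS.

End Complexification.

Section ComplexBilinear.
Variables (R : realType) (E F G : vectType R).
Variable f : {bilinear E -> F -> G}.

Definition complexify_bilinear (z : complexification E)
    (w : complexification F) : complexification G :=
  Cplx (f (creal z) (creal w) - f (cimag z) (cimag w))
       (f (creal z) (cimag w) + f (cimag z) (creal w)).

Lemma complexify_bilinear_subproof :
  bilinear_for *:%R *:%R complexify_bilinear.
Proof.
split=> [w [a b] z z'|z [a b] w w']; congr Cplx; apply: v2r_inj; apply/rowP=> i;
  rewrite /= !(linearBl, linearBr, linearDl, linearDr, linearZl_LR, linearZr_LR);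
  rewrite !(linearB, linearD, linearZ) !mxE /=; ring.
Qed.

HB.instance Definition _ :=
  bilinear_isBilinear.Build R[i] (complexification E) (complexification F)
    (complexification G) *:%R *:%R complexify_bilinear
    complexify_bilinear_subproof.

End ComplexBilinear.

Section Weights.
Variables (R : realType) (g V : vectType R[i]) (act : g -> V -> V).
Variable h : {vspace g}.

Definition functional := 'Hom(subvs_of h, R[i]^o).

Definition weight_space (lam : functional) : set V :=
  [set v | forall H : subvs_of h, act (vsval H) v = (lam H : R[i]) *: v].

Definition nonzero_weights : set functional :=
  [set lam | lam != 0 /\ exists2 v, v != 0 & weight_space lam v].

End Weights.
Arguments nonzero_weights {R g V} act h _.

Section Roots.
Variables (R : realType) (g : vectType R[i]) (br : {bilinear g -> g -> g}).
Variable h : {vspace g}.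
Notation dual := (functional h).

Definition roots : set dual := nonzero_weights br h.

Definition nonneg_comb (Delta : seq dual) (b : dual) : Prop :=
  exists n : 'I_(size Delta) -> nat, b = \sum_(i < size Delta) Delta`_i *+ n i.

Record root_base (Delta : seq dual) : Prop := {
  root_base_free : free Delta;
  root_base_root : forall a, a \in Delta -> roots a;
  root_base_comb : forall b, roots b ->
    nonneg_comb Delta b \/ nonneg_comb Delta (- b) }.

Definition enumerates (T : eqType) (s : seq T) (A : set T) : Prop :=
  uniq s /\ forall x, x \in s <-> A x.

Definition positive_roots (Phi Delta : seq dual) : seq dual :=
  [seq b <- Phi | `[< nonneg_comb Delta b >]].

(* H_a; it is unique because the Killing form is nondegenerate on h. *)
Definition root_vector (a : dual) : g :=
  vsval (xget 0 [set T : subvs_of h |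
    forall H : subvs_of h, killing_form br (vsval H) (vsval T) = a H]).

Definition coroot (a : dual) : g :=
  (2 / killing_form br (root_vector a) (root_vector a)) *: root_vector a.

(* [X] is a family of root vectors; only its values on roots are used. *)
Record chevalley_basis (Phi Delta : seq dual) (X : dual -> g) : Prop := {
  chevalley_is_basis :
    basis_of {:g} ([seq X b | b <- Phi] ++ [seq coroot a | a <- Delta]);
  chevalley_root_space : forall b, b \in Phi -> weight_space br b (X b);
  chevalley_opp : forall a, a \in Phi -> br (X a) (X (- a)) = coroot a;
  chevalley_add : exists C : dual -> dual -> R[i],
    forall a b, a \in Phi -> b \in Phi -> a + b \in Phi ->
      br (X a) (X b) = C a b *: X (a + b) /\ C a b = - C (- a) (- b) }.

Definition compact_coroot (a : dual) : g := 'i%C *: coroot a.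

Definition compact_family (Phi Delta : seq dual) (X : dual -> g) : seq g :=
  [seq compact_coroot a | a <- Delta] ++
  [seq X b - X (- b) | b <- positive_roots Phi Delta] ++
  [seq 'i%C *: X b + 'i%C *: X (- b) | b <- positive_roots Phi Delta].

End Roots.
Arguments roots {R g} br h _.

Section CompactChevalley.
Variables (R : realType) (g0 : vectType R) (br : {bilinear g0 -> g0 -> g0}).
Variable h0 : {vspace g0}.
Notation h := (complexify_vspace h0).
Notation brC := (complexify_bilinear br).

Record compact_chevalley_basis (Phi Delta : seq (functional h))
    (X : functional h -> complexification g0) (C0 : seq g0) : Prop := {
  ccb_maximal_abelian : maximal_abelian br h0;
  ccb_roots : enumerates Phi (roots brC h);
  ccb_base : root_base brC Delta;
  ccb_chevalley : chevalley_basis brC Phi Delta X;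
  ccb_family : [seq cinj x | x <- C0] = compact_family brC Phi Delta X;
  ccb_span : <<C0>>%VS = fullv;
  ccb_cartan_span : forall x, x \in h0 <-> exists c : functional h -> R,
    cinj x = \sum_(a <- Delta) (c a)%:C%C *: compact_coroot brC a }.

End CompactChevalley.

Section Rational.
Variables (R : realType) (W : vectType R).

Definition rat_span (s : seq W) : set W :=
  [set w | exists q : 'I_(size s) -> rat, w = \sum_(i < size s) ratr (q i) *: s`_i].

Definition rational_structure_constants (br : W -> W -> W) (s : seq W) : Prop :=
  forall i j k : 'I_(size s), rational (coord (in_tuple s) k (br s`_i s`_j)).

Definition rational_subspace (WQ A : set W) : Prop :=
  exists s : seq W,
    [/\ free s, forall w, w \in s -> WQ w & forall w, w \in <<s>>%VS <-> A w].

End Rational.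

Section Nilpotent.
Variables (R : realType) (U g0 : vectType R).
Variables (br : {bilinear g0 -> g0 -> g0}) (act : {bilinear g0 -> U -> U}).
Variable ip : {dot (U * g0)%type for idfun}.
Notation n0 := (U * g0)%type.

Definition inU (u : U) : n0 := (u, 0).
Definition inG (Z : g0) : n0 := (0, Z).

Record invariant_inner_product : Prop := {
  ip_orthogonal : forall u Z, ip (inU u) (inG Z) = 0;
  ip_act_skew : forall X u u',
    ip (inU (act X u)) (inU u') = - ip (inU u) (inU (act X u'));
  ip_ad_skew : forall X Y Z,
    ip (inG (br X Y)) (inG Z) = - ip (inG Y) (inG (br X Z)) }.

Record nilpotent_bracket (brn : {bilinear n0 -> n0 -> n0}) : Prop := {
  nilp_lie : lie_bracket brn;
  nilp_central : forall Z x, brn (inG Z) x = 0;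
  nilp_derived : forall x y, exists Z, brn x y = inG Z;
  nilp_ip : forall u u' Z,
    ip (brn (inU u) (inU u')) (inG Z) = ip (inU (act Z u)) (inU u') }.

Definition union_basis (B0 : seq U) (C0 : seq g0) : seq n0 :=
  [seq inU u | u <- B0] ++ [seq inG Z | Z <- C0].

(* With tau_a = [compact_coroot a], A_b = X_b - X_-b and B_b = iX_b + iX_-b:
   distinct elements of [L] are orthogonal, unless they are the compact coroots
   of simple roots [a], [b] that are not orthogonal to each other.  Such a pair
   can never be orthogonal: skewness of ad gives
   2 <tau_a, tau_b> = <tau_a, [A_b, B_b]> = b(coroot a) <B_b, B_b>. *)
Definition orthogonal_up_to_coroots (h0 : {vspace g0})
    (Delta : seq (functional (complexify_vspace h0))) (L : seq n0) : Prop :=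
  let brC := complexify_bilinear br in
  forall x y, x \in L -> y \in L -> x != y ->
    ip x y = 0 \/
    exists a b Za Zb,
      [/\ a \in Delta /\ b \in Delta,
          killing_form brC (root_vector brC a) (root_vector brC b) != 0,
          x = inG Za /\ cinj Za = compact_coroot brC a &
          y = inG Zb /\ cinj Zb = compact_coroot brC b].

Record admissible_basis (C0 : seq g0) (B0 : seq U) : Prop := {
  adm_basis : basis_of {:U} B0;
  adm_invariant : forall X v, X \in C0 -> rat_span B0 v -> rat_span B0 (act X v);
  adm_rational : forall x y, x \in union_basis B0 C0 ->
    y \in union_basis B0 C0 -> rational (ip x y) }.

End Nilpotent.
Arguments inU {R U} g0 u.
Arguments inG {R} U {g0} Z.

Section RealWeightSpaces.
Variables (R : realType) (U g0 : vectType R) (act : {bilinear g0 -> U -> U}).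
Variable h0 : {vspace g0}.
Notation h := (complexify_vspace h0).
Notation actC := (complexify_bilinear act).

Definition real_zero_weight_space : set U :=
  [set u | weight_space actC (0 : functional h) (cinj u)].

Definition real_weight_space (lam : functional h) : set U :=
  [set u | exists v w, [/\ weight_space actC lam v,
    weight_space actC (- lam) w & cinj u = v + w]].

Definition positive_weights (LamP : set (functional h)) : Prop :=
  LamP `<=` nonzero_weights actC h /\
  forall lam, nonzero_weights actC h lam -> (LamP lam <-> ~ LamP (- lam)).

End RealWeightSpaces.

(* Main.v *)
From HB Require Import structures.
Require Import Defs.
From mathcomp Require Import ring.

Set Implicit Arguments.
Unset Strict Implicit.
Unset Printing Implicit Defensive.

Import Order.TTheory GRing.Theory Num.Theory.
Import VectorInternalTheory.
Local Open Scope classical_set_scope.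
Local Open Scope ring_scope.

(** The inner product restricted to [g0] is positive definite and [ad]-invariant.
    Everything below rests on this, on the eigenvalue theory of sl_2, and on
    linear algebra over the rationals.

    The maximal abelian subalgebra [h0] acts on [g0] by skew operators, so the
    weights are imaginary on [h0] and complex conjugation exchanges the root
    spaces of [b] and [- b] ([weight_opp]).  Hence twice the number of positive
    roots is at most the number of roots; since a Chevalley basis has as many
    elements as roots and simple roots together, the spanning family [C0] is a
    basis of [g0] ([compact_chevalley_is_basis]).

    The structure constants are rational because the bracket of two elements of
    [B0] is determined by its inner products with [C0], which are the rational
    numbers [<Z u, u'>]; a vector having rational products with a basis whose
    Gram matrix is rational is a rational combination of it
    ([rat_span_pairing]).  This follows from Gram-Schmidt, which never leaves the
    rational span ([rational_Gram_Schmidt]) and also replaces [B0] by an orthogonal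
    basis with the same rational span.  Inside [C0] orthogonality comes from
    invariance: root spaces of [b] and [c] are orthogonal for the complexified
    form unless [b + c = 0] ([weight_spaces_orthogonal]), [A_b] and [B_b] are
    orthogonal by symmetry, and [<tau_a, tau_b>] is a multiple of [b(tau_a)]
    ([coroots_orthogonal]).

    The weight spaces are common kernels of operators that preserve the rational
    span of [B0].  With [tau_a] the compact coroots, which span [h0], the space
    [U_0] is the common kernel of the [tau_a].  If [lam] takes the value [m_a] on
    the coroot of [a], then [U_lam] is the common kernel of the operators
    [tau_a tau_b + m_a m_b] ([real_weight_spaceP]), which are rational since
    [m_a] is an integer by sl_2 theory ([weight_coroot_integral]).  Finally,
    Gaussian elimination gives common kernels of rational operators rational
    bases ([rational_subspace_kernels]). *)

(** * Linear algebra over the rational numbers *)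

Section RationalNumbers.
Variable R : realType.
Implicit Types x y : R.

Lemma rational_ratr (q : rat) : rational (ratr q : R).
Proof. by exists q. Qed.

Lemma rationalD x y : rational x -> rational y -> rational (x + y).
Proof. by move=> [p _ <-] [q _ <-]; exists (p + q); rewrite ?rmorphD. Qed.

Lemma rationalM x y : rational x -> rational y -> rational (x * y).
Proof. by move=> [p _ <-] [q _ <-]; exists (p * q); rewrite ?rmorphM. Qed.

Lemma rationalV x : rational x -> rational x^-1.
Proof. by move=> [p _ <-]; exists p^-1; rewrite ?fmorphV. Qed.

Lemma rational_int (m : int) : rational (m%:~R : R).
Proof. by exists m%:~R; rewrite ?ratr_int. Qed.

Lemma rational0 : rational (0 : R).
Proof. exact: (rational_int 0). Qed.

End RationalNumbers.

Section RationalSpan.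
Variables (R : realType) (W : vectType R).
Implicit Types (s t : seq W) (v w : W).

Lemma rat_span_mem s w : w \in s -> rat_span s w.
Proof.
move=> sw; have lt_ws : (index w s < size s)%N by rewrite index_mem.
exists (fun i => (i == Ordinal lt_ws)%:R).
rewrite (bigD1 (Ordinal lt_ws)) //= eqxx rmorph1 scale1r nth_index //.
by rewrite big1 ?addr0 // => i /negPf ->; rewrite rmorph0 scale0r.
Qed.

Lemma rat_span0 s : rat_span s 0.
Proof. by exists (fun=> 0); rewrite big1 // => i _; rewrite rmorph0 scale0r. Qed.

Lemma rat_spanD s v w : rat_span s v -> rat_span s w -> rat_span s (v + w).
Proof.
move=> [p ->] [q ->]; exists (fun i => p i + q i).
by rewrite -big_split; apply: eq_bigr => i _; rewrite rmorphD scalerDl.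
Qed.

Lemma rat_spanZ s (a : R) w : rational a -> rat_span s w -> rat_span s (a *: w).
Proof.
move=> [c _ <-] [q ->]; exists (fun i => c * q i).
by rewrite scaler_sumr; apply: eq_bigr => i _; rewrite rmorphM scalerA.
Qed.

Lemma rat_spanB s v w : rat_span s v -> rat_span s w -> rat_span s (v - w).
Proof.
move=> sv sw; apply: rat_spanD => //; rewrite -scaleN1r.
by apply: rat_spanZ => //; apply: (@rational_int R (-1)).
Qed.

Lemma rat_span_sum s (I : Type) (r : seq I) (P : pred I) (F : I -> W) :
  (forall i, P i -> rat_span s (F i)) -> rat_span s (\sum_(i <- r | P i) F i).
Proof.
by move=> sF; elim/big_ind: _ => //; [exact: rat_span0 | exact: rat_spanD].
Qed.

Lemma rat_span_rect s (P : W -> Prop) :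
    P 0 -> (forall v w, P v -> P w -> P (v + w)) ->
    (forall a w, rational a -> w \in s -> P (a *: w)) ->
  forall w, rat_span s w -> P w.
Proof.
move=> P0 PD PZ w [q ->]; elim/big_ind: _ => // i _.
by apply: PZ; [exact: rational_ratr | exact: mem_nth].
Qed.

Lemma rat_span_trans s t w :
  {in s, forall v, rat_span t v} -> rat_span s w -> rat_span t w.
Proof.
move=> st; apply: rat_span_rect; [exact: rat_span0 | exact: rat_spanD |].
by move=> a v ra sv; apply: rat_spanZ => //; apply: st.
Qed.

Lemma rat_span_span s w : rat_span s w -> w \in <<s>>%VS.
Proof.
apply: (@rat_span_rect s (fun w => w \in <<s>>%VS)).
- exact: mem0v.
- exact: memvD.
- by move=> a v _ sv; apply: memvZ; apply: memv_span.
Qed.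

Lemma span_rat_span s t : {in s, forall v, rat_span t v} -> (<<s>> <= <<t>>)%VS.
Proof. by move=> st; apply/span_subvP => v /st/rat_span_span. Qed.

Lemma rat_span_coord s (k : 'I_(size s)) w :
  free s -> rat_span s w -> rational (coord (in_tuple s) k w).
Proof.
by move=> fs [q ->]; rewrite coord_sum_free //; apply: rational_ratr.
Qed.

(** Gaussian elimination: if [phi x] is nonzero for a basis element [x], trading
    the other elements [y] for [y - (phi y / phi x) *: x] moves them into the
    kernel without changing the span or leaving the rational one. *)
Lemma rational_subspace_kernel_functional s0 (A : set W) (phi : {linear W -> R^o}) :
    (forall w, rat_span s0 w -> rational (phi w : R)) ->
    rational_subspace (rat_span s0) A ->
  rational_subspace (rat_span s0) [set w | A w /\ phi w = 0].
Proof.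
move=> phiQ [s [fs sQ sA]].
have [s_ker|/allPn[x sx phix]] := boolP (all (fun x => phi x == 0) s).
  exists s; split=> // w; split=> [sw|[Aw _]]; last exact/sA.
  split; first exact/sA.
  have /span_subvP : {subset s <= lker (linfun phi)}.
    by move=> y /(allP s_ker) y0; rewrite memv_ker lfunE.
  by move=> /subvP /(_ w sw); rewrite memv_ker lfunE => /eqP.
(* [x] is the pivot, and [g y] the element [y] after elimination. *)
have sE := perm_to_rem sx; set s' := rem x s in sE.
pose g y := y - (phi y / phi x : R) *: x.
pose t := [seq g y | y <- s'].
have phig y : phi (g y) = 0.
  rewrite linearB linearZ /= /GRing.scale /= divfK ?subrr //.
have t_ker : (<<t>> <= lker (linfun phi))%VS.
  by apply/span_subvP => _ /mapP[y _ ->]; rewrite memv_ker lfunE /= phig.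
have span_xt : <<x :: t>>%VS = <<s>>%VS.
  rewrite (eq_span (perm_mem sE)); apply/eqP; rewrite eqEsubv.
  apply/andP; split; apply/span_subvP => z; rewrite inE.
    case/predU1P=> [->|/mapP[y s'y ->]]; first by rewrite memv_span ?mem_head.
    by rewrite rpredB ?rpredZ ?memv_span ?mem_head // inE s'y orbT.
  case/predU1P=> [->|s'z]; first by rewrite memv_span ?mem_head.
  rewrite -[z](subrK ((phi z / phi x : R) *: x)) rpredD ?rpredZ //.
    by rewrite memv_span // inE (map_f g s'z) orbT.
  by rewrite memv_span ?mem_head.
have fxt : free (x :: t).
  rewrite /free span_xt (eqP (fs : _ == _)) /= size_map.
  by rewrite (perm_size sE).
exists t; split.
- by move: fxt; rewrite free_cons => /andP[].
- move=> _ /mapP[y s'y ->]; have sy : y \in s by rewrite (perm_mem sE) inE s'y orbT.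
  apply: rat_spanB; first exact: sQ.
  apply: rat_spanZ; last exact: sQ.
  by apply: rationalM; [|apply: rationalV]; apply: phiQ; apply: sQ.
- move=> w; split=> [tw|[/sA sw phiw]].
    split; last by move/subvP: t_ker => /(_ w tw); rewrite memv_ker lfunE => /eqP.
    by apply/sA; rewrite -span_xt span_cons; apply: (subvP (addvSr _ _)).
  move: sw; rewrite -span_xt span_cons => /memv_addP[_ /vlineP[a ->]] [v tv wE].
  move: phiw; rewrite wE linearD linearZ /=.
  have /eqP-> : phi v == 0 by move/subvP: t_ker => /(_ v tv); rewrite memv_ker lfunE.
  rewrite addr0 => /eqP; rewrite scaler_eq0 (negPf phix) orbF => /eqP->.
  by rewrite scale0r add0r.
Qed.

End RationalSpan.

Section RationalOperators.
Variables (R : realType) (W E : vectType R).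

(** A vector is zero when its coordinates in a basis are, so an operator with
    rational matrix is cut down to finitely many rational functionals. *)
Lemma rational_subspace_kernel (s0 : seq W) (B : seq E) (A : set W)
    (T : {linear W -> E}) :
    basis_of fullv B ->
    (forall w, rat_span s0 w -> rat_span B (T w)) ->
    rational_subspace (rat_span s0) A ->
  rational_subspace (rat_span s0) [set w | A w /\ T w = 0].
Proof.
move=> basB TQ ratA; pose phi i w := coord (in_tuple B) i (T w).
have phi_lin i : linear (phi i : W -> R^o) by move=> a v w; rewrite /phi !linearP.
pose phiL i : {linear W -> R^o} :=
  HB.pack (phi i : W -> R^o) (GRing.isLinear.Build _ _ _ _ (phi i : W -> R^o) (phi_lin i)).
have {ratA} ratk (k : seq 'I_(size B)) :
    rational_subspace (rat_span s0) [set w | A w /\ {in k, forall i, phi i w = 0}].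
  elim: k => [|i k IH].
    by congr rational_subspace: ratA; apply/seteqP; split=> w //= [].
  have := rational_subspace_kernel_functional (phi := phiL i) _ IH.
  move=> /(_ (fun w Qw => rat_span_coord i (basis_free basB) (TQ w Qw))).
  congr rational_subspace; apply/seteqP; split=> w /=.
    by move=> [[Aw kw] iw]; split=> // j; rewrite inE => /predU1P[->|/kw].
  move=> [Aw kw]; split; last by apply: kw; rewrite mem_head.
  by split=> // j kj; apply: kw; rewrite inE kj orbT.
congr rational_subspace: (ratk (enum 'I_(size B))); apply/seteqP; split=> w /=.
  move=> [Aw w0]; split=> //.
  rewrite (coord_basis (X := in_tuple B) basB (memvf (T w))) big1 // => i _.
  by have := w0 i (mem_enum _ i); rewrite /phi => ->; rewrite scale0r.
by move=> [Aw w0]; split=> // i _; rewrite /phi w0 linear0.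
Qed.

Lemma rational_subspace_kernels (I : eqType) (r : seq I) (s0 : seq W) (B : seq E)
    (A : set W) (T : I -> {linear W -> E}) :
    basis_of fullv B ->
    (forall i w, i \in r -> rat_span s0 w -> rat_span B (T i w)) ->
    rational_subspace (rat_span s0) A ->
  rational_subspace (rat_span s0) [set w | A w /\ {in r, forall i, T i w = 0}].
Proof.
move=> basB; elim: r => [|i r IH] TQ ratA.
  by congr rational_subspace: ratA; apply/seteqP; split=> w //= [].
have ratr : rational_subspace (rat_span s0) [set w | A w /\ {in r, forall i, T i w = 0}].
  by apply: IH => // j w rj; apply: TQ; rewrite inE rj orbT.
have := rational_subspace_kernel basB (fun w => TQ i w (mem_head _ _)) ratr.
congr rational_subspace; apply/seteqP; split=> w /=.
  by move=> [[Aw kw] iw]; split=> // j; rewrite inE => /predU1P[->|/kw].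
move=> [Aw kw]; split; last by apply: kw; rewrite mem_head.
by split=> // j kj; apply: kw; rewrite inE kj orbT.
Qed.

Lemma rat_span_map (j : {linear W -> E}) s w :
  rat_span s w -> rat_span [seq j x | x <- s] (j w).
Proof.
apply: (@rat_span_rect _ _ s (fun w => rat_span [seq j x | x <- s] (j w))).
- by rewrite linear0; apply: rat_span0.
- by move=> u v; rewrite linearD; apply: rat_spanD.
- move=> a u ra su; rewrite linearZ; apply: rat_spanZ => //.
  by apply: rat_span_mem; apply: map_f.
Qed.

End RationalOperators.

(** * Orthogonalization over the rational numbers *)

Section GramSchmidt.
Variables (R : realType) (W : vectType R) (ip : {dot W for idfun}).
Implicit Types (s t : seq W) (v w : W).

Lemma ip_sym v w : ip v w = ip w v.
Proof. by rewrite [LHS](hermitian_subproof (s := ip)) /= expr0 mul1r. Qed.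

Definition orthogonal_seq t := {in t &, forall x y, x != y -> ip x y = 0}.

Lemma ip_sum_orthogonal t (c : W -> R) x : uniq t -> orthogonal_seq t -> x \in t ->
  ip x (\sum_(y <- t) c y *: y) = c x * ip x x.
Proof.
move=> ut ot tx; rewrite linear_sumr (bigD1_seq x) //= linearZr_LR /=.
rewrite big_seq_cond big1 ?addr0 // => y /andP[ty yx].
by rewrite linearZr_LR /= ot ?mulr0 // eq_sym.
Qed.

Lemma rational_ip s v w : {in s &, forall x y, rational (ip x y)} ->
  rat_span s v -> rat_span s w -> rational (ip v w).
Proof.
move=> sQ sv sw; move: v sv.
apply: rat_span_rect; first by rewrite linear0l; apply: rational0.
  by move=> v v' ? ?; rewrite linearDl; apply: rationalD.
move=> a x ra sx; rewrite linearZl_LR /=; apply: rationalM => //; move: w sw.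
apply: rat_span_rect; first by rewrite linear0r; apply: rational0.
  by move=> v v' ? ?; rewrite linearDr; apply: rationalD.
by move=> b y rb sy; rewrite linearZr_LR /=; apply: rationalM => //; apply: sQ.
Qed.

(** Gram-Schmidt orthogonalization divides only by values of the form, so it
    does not leave the rational span. *)
Lemma rational_Gram_Schmidt s :
    free s -> {in s &, forall x y, rational (ip x y)} ->
  exists t, [/\ free t, size t = size s, orthogonal_seq t,
    {in t, forall x, rat_span s x} & {in s, forall x, rat_span t x}].
Proof.
elim: s => [|x s IH] fs sQ.
  by exists [::]; split.
have fs' : free s by move: fs; rewrite free_cons => /andP[].
have sub_s : {subset s <= x :: s} by move=> y sy; rewrite inE sy orbT.
have [|t [ft szt ot ts st]] := IH fs'; first exact: sub_in2 sQ.
pose c y := ip y x / ip y y.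
pose z := x - \sum_(y <- t) c y *: y.
have xsQ v : rat_span s v -> rat_span (x :: s) v.
  by apply: rat_span_trans => y sy; apply: rat_span_mem; apply: sub_s.
have cQ y : y \in t -> rational (c y).
  move=> ty; apply: rationalM; [|apply: rationalV]; apply: (rational_ip sQ);
    do ?[exact/xsQ/ts]; exact/rat_span_mem/mem_head.
have zs : rat_span (x :: s) z.
  apply: rat_spanB; first exact/rat_span_mem/mem_head.
  rewrite big_seq; apply: rat_span_sum => y ty.
  by apply: rat_spanZ; [exact: cQ | exact/xsQ/ts].
have zt : {in t, forall y, ip y z = 0}.
  move=> y ty; have -> : ip y z = ip y x - ip y (\sum_(y <- t) c y *: y) by rewrite linearBr.
  rewrite ip_sum_orthogonal ?free_uniq //.
  rewrite /c divfK ?subrr // gt_eqF // neq0_dnorm_gt0 //.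
  exact: free_not0 ft ty.
have ztx : rat_span (z :: t) x.
  rewrite -[x](subrK (\sum_(y <- t) c y *: y)); apply: rat_spanD.
    exact/rat_span_mem/mem_head.
  rewrite big_seq; apply: rat_span_sum => y ty.
  by apply: rat_spanZ; [exact: cQ | apply: rat_span_mem; rewrite inE ty orbT].
have st' : {in x :: s, forall y, rat_span (z :: t) y}.
  move=> y; rewrite inE => /predU1P[->//|/st]; apply: rat_span_trans => v tv.
  by apply: rat_span_mem; rewrite inE tv orbT.
have ts' : {in z :: t, forall y, rat_span (x :: s) y}.
  by move=> y; rewrite inE => /predU1P[->//|/ts/xsQ].
exists (z :: t); split=> //; last 2 first.
- by rewrite /= szt.
- move=> u v; rewrite !inE => /predU1P[->|tu] /predU1P[->|tv]; rewrite ?eqxx //.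
  + by move=> _; rewrite ip_sym zt.
  + by move=> _; rewrite zt.
  + exact: ot.
have span_eq : <<z :: t>>%VS = <<x :: s>>%VS.
  by apply/eqP; rewrite eqEsubv !span_rat_span.
by rewrite /free span_eq (eqP (fs : _ == _)) /= szt.
Qed.

(** Coordinates in an orthogonal basis are quotients of values of the form. *)
Lemma rat_span_pairing s w :
    free s -> {in s &, forall x y, rational (ip x y)} ->
    w \in <<s>>%VS -> {in s, forall x, rational (ip x w)} -> rat_span s w.
Proof.
move=> fs sQ sw wQ; have [t [ft szt ot ts st]] := rational_Gram_Schmidt fs sQ.
have ipwQ v : rat_span s v -> rational (ip v w).
  move: v; apply: rat_span_rect; first by rewrite linear0l; apply: rational0.
    by move=> v v' ? ?; rewrite linearDl; apply: rationalD.
  by move=> a x ra sx; rewrite linearZl_LR /=; apply: rationalM => //; apply: wQ.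
have tw : w \in <<t>>%VS by apply: (subvP (span_rat_span st)).
(* The coordinate of [w] at [x] is [<x, w> / <x, x>]. *)
have [c wE _] := free_span ft tw.
rewrite wE big_seq; apply: rat_span_sum => x tx; apply: rat_spanZ; last exact: ts.
have xx : ip x x != 0 by rewrite gt_eqF // neq0_dnorm_gt0 // (free_not0 ft tx).
have -> : c x = ip x w / ip x x.
  by rewrite wE ip_sum_orthogonal ?free_uniq // mulfK.
apply: rationalM; [exact/ipwQ/ts | apply: rationalV].
by apply: (rational_ip sQ); apply: ts.
Qed.

End GramSchmidt.

(** * Eigenvalues in representations of sl_2 *)

Section SL2.
Variables (F : numFieldType) (V : vectType F).

(** Eigenvalues are roots of the characteristic polynomial, so a chain of
    eigenvectors whose eigenvalues move in steps of [d] has to reach zero. *)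
Lemma eigenvector_chain_stops (h g : {linear V -> V}) (c d : F) (v : V) :
    d != 0 -> (forall k, h (iter k g v) = (c + d *+ k) *: iter k g v) ->
  exists k, iter k g v == 0.
Proof.
move=> d0 hv; apply: contrapT => /forallNP nz.
pose M := lin1_mx (v2r \o h \o r2v).
pose s := [seq c + d *+ k | k <- iota 0 (size (char_poly M))].
(* More distinct roots than the degree allows. *)
have us : uniq s.
  rewrite map_inj_uniq ?iota_uniq // => i j /addrI /eqP.
  by rewrite -!(mulr_natr d) (inj_eq (mulfI d0)) eqr_nat => /eqP.
have rs : all (root (char_poly M)) s.
  apply/allP => _ /mapP[k _ ->]; rewrite -eigenvalue_root_char.
  apply/eigenvalueP; exists (v2r (iter k g v)).
    by rewrite mul_rV_lin1 /= v2rK hv linearZ.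
  by apply/negP => /eqP/(canRL v2rK); rewrite linear0 => /eqP/nz.
have := max_poly_roots (monic_neq0 (char_poly_monic M)) rs us.
by rewrite size_map size_iota ltnn.
Qed.

(** Raise an eigenvector until it becomes primitive, then lower it: the first
    [j.+1] such that [f ^ j.+1] kills the primitive vector forces its
    eigenvalue [mu] to be [j], since [e (f ^ j.+1 w) = (j + 1) (mu - j) f ^ j w]. *)
Lemma sl2_eigenvalue_integral (e f h : {linear V -> V}) (c : F) (v : V) :
    (forall u, h (e u) = e (h u) + 2 *: e u) ->
    (forall u, h (f u) = f (h u) - 2 *: f u) ->
    (forall u, e (f u) = f (e u) + h u) ->
    v != 0 -> h v = c *: v ->
  exists m : int, c = m%:~R.
Proof.
move=> he hf ef v0 hv.
have hek k : h (iter k e v) = (c + 2 *+ k) *: iter k e v.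
  elim: k => [|k IH]; first by rewrite /= mulr0n addr0.
  by rewrite iterS he IH linearZ -scalerDl [_ *+ k.+1]mulrSr -addrA.
have ex_e : exists k, iter k e v == 0.
  by apply: eigenvector_chain_stops hek; rewrite pnatr_eq0.
case: (ex_minnP ex_e) => [[|k] /eqP ek min_k]; first by rewrite (ek : v = 0) eqxx in v0.
set w := iter k e v in hek ek; set mu := c + 2 *+ k.
have ew : e w = 0 by [].
have w0 : w != 0 by apply/negP => /min_k; rewrite ltnn.
have hw : h w = mu *: w by apply: hek.
have hfj j : h (iter j f w) = (mu + (- 2) *+ j) *: iter j f w.
  elim: j => [|j IH]; first by rewrite /= mulr0n addr0.
  by rewrite iterS hf IH linearZ -scalerBl [_ *+ j.+1]mulrSr -addrA.
have ex_f : exists j, iter j f w == 0.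
  by apply: eigenvector_chain_stops hfj; rewrite oppr_eq0 pnatr_eq0.
case: (ex_minnP ex_f) => [[|j] /eqP fj min_j]; first by rewrite (fj : w = 0) eqxx in w0.
have efj i : e (iter i.+1 f w) = (i.+1%:R * (mu - i%:R)) *: iter i f w.
  elim: i => [|i IH].
    by rewrite iterS ef /= ew linear0 add0r hw subr0 mul1r.
  rewrite iterS ef IH linearZ hfj -scalerDl /=; congr (_ *: _).
  by rewrite mulNrn -mulr_natr -!natr1; ring.
have wj0 : iter j f w != 0 by apply/negP => /min_j; rewrite ltnn.
have := efj j; rewrite fj linear0 => /esym/eqP.
rewrite scaler_eq0 (negPf wj0) orbF mulf_eq0 pnatr_eq0 /= subr_eq0 => /eqP muE.
exists (j%:Z - (2 * k)%:Z); rewrite rmorphB /= -!pmulrn -muE /mu.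
by rewrite natrM mulr_natr addrK.
Qed.

End SL2.

(** * Complexification and weight spaces *)

Section Complexify.
Variable R : realType.
Implicit Types E F G : vectType R.

Lemma cinj_is_linear E (a : R) (x y : E) :
  cinj (a *: x + y) = a%:C%C *: cinj x + cinj y.
Proof.
by congr Cplx; rewrite /= ?scaler0 ?scale0r ?subr0 ?addr0.
Qed.

Lemma cinjZ E (a : R) (x : E) : cinj (a *: x) = a%:C%C *: cinj x.
Proof. by rewrite -[a *: x]addr0 cinj_is_linear addr0. Qed.

Lemma cinj_inj E : injective (@cinj R E).
Proof. by move=> x y []. Qed.

Lemma cplx_split E (z : complexification E) :
  z = cinj (creal z) + 'i%C *: cinj (cimag z).
Proof.
by case: z => x y; congr Cplx;
  rewrite /= !scale0r !scale1r ?scaler0 ?subr0 ?addr0 ?add0r.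
Qed.

Lemma dim_complexification E : \dim {: complexification E} = \dim {: E}.
Proof. by rewrite !dimvf. Qed.

Lemma creal_sum E (I : Type) (r : seq I) (P : pred I) (z : I -> complexification E) :
  creal (\sum_(i <- r | P i) z i) = \sum_(i <- r | P i) creal (z i).
Proof. exact: (big_morph (@creal R E)). Qed.

Lemma cimag_sum E (I : Type) (r : seq I) (P : pred I) (z : I -> complexification E) :
  cimag (\sum_(i <- r | P i) z i) = \sum_(i <- r | P i) cimag (z i).
Proof. exact: (big_morph (@cimag R E)). Qed.

Lemma cinj_sum E (I : Type) (r : seq I) (P : pred I) (x : I -> E) :
  cinj (\sum_(i <- r | P i) x i) = \sum_(i <- r | P i) cinj (x i).
Proof.
apply: (big_morph (@cinj R E)) => // u v.
by rewrite -[u in LHS]scale1r cinj_is_linear scale1r.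
Qed.

Definition cconj E (z : complexification E) := Cplx (creal z) (- cimag z).

Lemma cconj_eq0 E (z : complexification E) : (cconj z == 0) = (z == 0).
Proof.
case: z => x y; apply/eqP/eqP => [[-> /eqP]|[-> ->]]; last by rewrite /cconj oppr0.
by rewrite oppr_eq0 => /eqP->.
Qed.

Lemma mem_complexify E (A : {vspace E}) (z : complexification E) :
  (z \in complexify_vspace A) = (creal z \in A) && (cimag z \in A).
Proof.
apply/idP/andP => [|[xA yA]].
  pose s := [seq cinj x | x <- vbasis A]; move=> zA.
  have /coord_span -> : z \in <<in_tuple s>>%VS by [].
  rewrite creal_sum cimag_sum; split; apply: memv_suml => i _ /=;
    have /mapP[x xA ->] : s`_i \in s by rewrite mem_nth.
    by rewrite /= scaler0 subr0 memvZ // vbasis_mem.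
  by rewrite /= scaler0 add0r memvZ // vbasis_mem.
have cinjA x : x \in A -> cinj x \in complexify_vspace A.
  move=> /coord_vbasis ->; rewrite cinj_sum; apply: memv_suml => i _.
  rewrite cinjZ memvZ // memv_span // map_f // mem_nth //.
  by rewrite size_tuple.
by rewrite [z]cplx_split memvD ?memvZ ?cinjA.
Qed.

Lemma complexify_bilinear_cinj E F G (f : {bilinear E -> F -> G}) x w :
  complexify_bilinear f (cinj x) w = Cplx (f x (creal w)) (f x (cimag w)).
Proof. by congr Cplx; rewrite /= linear0l ?subr0 ?addr0. Qed.

Lemma complexify_bilinear_cconj E F G (f : {bilinear E -> F -> G}) z w :
  cconj (complexify_bilinear f z w) = complexify_bilinear f (cconj z) (cconj w).
Proof.
congr Cplx; rewrite /= !(linearNl, linearNr) ?opprK //.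
by rewrite opprD.
Qed.

Lemma complexify_sym E G (f : {bilinear E -> E -> G}) :
  (forall x y, f x y = f y x) ->
  forall z w, complexify_bilinear f z w = complexify_bilinear f w z.
Proof.
move=> fC z w; congr Cplx; first by congr (_ - _).
by rewrite /= addrC; congr (_ + _).
Qed.

Lemma alternating_antisym E G (f : {bilinear E -> E -> G}) :
  (forall x, f x x = 0) -> forall x y, f x y = - f y x.
Proof.
move=> fxx x y; apply/eqP; rewrite -addr_eq0; apply/eqP.
by have := fxx (x + y); rewrite linearDl !linearDr !fxx add0r addr0.
Qed.

Lemma complexify_alt E G (f : {bilinear E -> E -> G}) :
  (forall x, f x x = 0) ->
  forall z w, complexify_bilinear f z w = - complexify_bilinear f w z.
Proof.
move=> /alternating_antisym fN z w; congr Cplx => /=.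
  by rewrite opprB [X in X - _]fN [X in _ - X]fN opprK addrC.
by rewrite opprD addrC; congr (_ + _).
Qed.

Lemma complexify_skew E F G (act : {bilinear E -> F -> F}) (f : {bilinear F -> F -> G}) :
  (forall x y z, f (act x y) z = - f y (act x z)) ->
  forall x y z, complexify_bilinear f (complexify_bilinear act x y) z =
    - complexify_bilinear f y (complexify_bilinear act x z).
Proof.
move=> skew x y z; congr Cplx; apply: v2r_inj; apply/rowP=> i;
  rewrite /= !(linearBl, linearBr, linearDl, linearDr) !skew;
  rewrite !(linearB, linearD, linearN) !mxE /=; ring.
Qed.

Lemma complexify_lie_module E F (br : {bilinear E -> E -> E})
    (act : {bilinear E -> F -> F}) : lie_module br act ->
  forall x y u, complexify_bilinear act (complexify_bilinear br x y) u =
    complexify_bilinear act x (complexify_bilinear act y u) -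
    complexify_bilinear act y (complexify_bilinear act x u).
Proof.
move=> mod [x x'] [y y'] [u u']; congr Cplx; apply: v2r_inj; apply/rowP=> i;
  rewrite /= !(linearBl, linearBr, linearDl, linearDr) !mod;
  rewrite !(linearB, linearD, linearN) !mxE /=; ring.
Qed.

End Complexify.

Section WeightSpaces.
Variables (R : realType) (g0 U : vectType R) (act : {bilinear g0 -> U -> U}).
Variable h0 : {vspace g0}.
Notation h := (complexify_vspace h0).
Notation actC := (complexify_bilinear act).
Implicit Types lam mu : functional h.

(** Precomposing with the projection onto [h] makes a weight a linear form on the
    whole algebra, to be evaluated without passing to the subtype of [h]. *)
Definition fval lam (z : complexification g0) : R[i] := lam (vsproj h z).

Lemma fval_is_linear lam : linear (fval lam : _ -> R[i]^o).
Proof. by move=> a z w; rewrite /fval !linearP. Qed.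
HB.instance Definition _ lam :=
  GRing.isLinear.Build R[i] (complexification g0) R[i]^o _ (fval lam : _ -> R[i]^o)
    (fval_is_linear lam).

Lemma fvalD lam z w : fval lam (z + w) = fval lam z + fval lam w.
Proof. exact: linearD. Qed.

Lemma fvalZ lam a z : fval lam (a *: z) = a * fval lam z.
Proof. exact: linearZ. Qed.

Lemma weight_spaceP lam v :
  weight_space actC lam v <-> {in h, forall z, actC z v = fval lam z *: v}.
Proof.
split=> [wv z zh|wv H].
  by rewrite -[z in LHS](vsprojK zh) wv.
by rewrite wv ?subvsP // /fval vsvalK.
Qed.

Lemma weight_space_real lam v :
  {in h0, forall x, actC (cinj x) v = fval lam (cinj x) *: v} ->
  weight_space actC lam v.
Proof.
move=> wv; apply/weight_spaceP => z; rewrite mem_complexify => /andP[xh yh].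
rewrite [z]cplx_split linearDl linearZl_LR /= !wv // fvalD fvalZ.
by rewrite scalerDl scalerA.
Qed.

End WeightSpaces.

Section SkewModule.
Variables (R : realType) (g0 U : vectType R) (act : {bilinear g0 -> U -> U}).
Variables (h0 : {vspace g0}) (f : {bilinear U -> U -> R^o}).
Notation h := (complexify_vspace h0).
Notation actC := (complexify_bilinear act).
Hypothesis f_sym : forall u v, f u v = f v u.
Hypothesis f_pos : forall u, u != 0 -> 0 < (f u u : R).
Hypothesis f_skew : forall x u v, f (act x u) v = - f u (act x v).

Lemma skew_diag x u : f (act x u) u = 0.
Proof.
have /eqP := f_skew x u u; rewrite [f u _]f_sym -addr_eq0 -mulr2n.
by rewrite -scaler_nat scaler_eq0 pnatr_eq0 => /eqP.
Qed.

(** For [v = v1 + i v2] with eigenvalue [a + i b], skewness gives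
    [a (<v1, v1> + <v2, v2>) = 0]. *)
Lemma weight_imaginary (lam : functional h) v x :
  weight_space actC lam v -> v != 0 -> x \in h0 ->
  complex.Re (fval lam (cinj x)) = 0.
Proof.
move=> /weight_spaceP wv v0 xh; have xC : cinj x \in h.
  by rewrite mem_complexify xh mem0v.
have := wv _ xC; rewrite complexify_bilinear_cinj; case: v v0 {wv} => u w v0 /=.
case: (fval lam _) => a b [actu actw] /=.
have := skew_diag x u; rewrite actu linearBl !linearZl_LR /= => /eqP.
rewrite subr_eq0 => /eqP fu.
have := skew_diag x w; rewrite actw linearDl !linearZl_LR /= => /eqP fw.
have : a * (f u u + f w w : R) = 0.
  by rewrite mulrDr [a * _ in LHS]fu (f_sym w u) addrC; apply/eqP.
move/eqP; rewrite mulf_eq0 => /orP[/eqP//|]; rewrite gt_eqF //.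
have f_ge0 z : 0 <= (f z z : R).
  by have [->|/f_pos/ltW//] := eqVneq z 0; rewrite linear0l.
have [u0|/f_pos fu0] := eqVneq u 0; last exact: ltr_pwDl.
apply: ltr_wpDl => //; apply: f_pos; apply: contra v0 => /eqP->.
by rewrite u0.
Qed.

(** Weights take imaginary values on [h0], so complex conjugation, which fixes
    [h0], maps the [lam]-weight space onto the [- lam]-weight space. *)
Lemma weight_opp (lam : functional h) v :
  v != 0 -> weight_space actC lam v -> weight_space actC (- lam) (cconj v).
Proof.
move=> v0 wv; apply: weight_space_real => x xh.
have xC : cinj x \in h by rewrite mem_complexify xh mem0v.
have fvalN : fval (- lam) (cinj x) = - fval lam (cinj x) by rewrite /fval opp_lfunE.
have {1}-> : cinj x = cconj (cinj x) by rewrite /cconj /= oppr0.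
rewrite -complexify_bilinear_cconj (iffLR (weight_spaceP _ _ _) wv _ xC) fvalN.
have := weight_imaginary wv v0 xh.
case: (fval lam _) => a b /= ->; congr Cplx; rewrite /= !oppr0 !scale0r.
  by rewrite !sub0r scaleNr scalerN opprK.
by rewrite !add0r scaleNr.
Qed.

Lemma nonzero_weights_opp (lam : functional h) :
  nonzero_weights actC h lam -> nonzero_weights actC h (- lam).
Proof.
move=> [lam0 [v v0 wv]]; split; first by rewrite oppr_eq0.
by exists (cconj v); [rewrite cconj_eq0 | apply: weight_opp].
Qed.

End SkewModule.

(** * Compact Chevalley bases *)

Section CompactChevalley.
Variables (R : realType) (g0 : vectType R) (br : {bilinear g0 -> g0 -> g0}).
Variables (h0 : {vspace g0}) (Phi Delta : seq (functional (complexify_vspace h0))).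
Variables (X : functional (complexify_vspace h0) -> complexification g0).
Variables (C0 : seq g0) (f : {bilinear g0 -> g0 -> R^o}).
Notation h := (complexify_vspace h0).
Notation brC := (complexify_bilinear br).
Notation killingC := (@killing_form R[i] (complexification g0) brC).
Notation fC := (complexify_bilinear f).
Notation Phip := (positive_roots Phi Delta).
Hypothesis br_alt : forall x, br x x = 0.
Hypothesis ccb : compact_chevalley_basis br Phi Delta X C0.
Hypothesis f_sym : forall u v, f u v = f v u.
Hypothesis f_pos : forall u, u != 0 -> 0 < (f u u : R).
Hypothesis f_skew : forall x u v, f (br x u) v = - f u (br x v).

Let chev := ccb_chevalley ccb.
Let base := ccb_base ccb.

Lemma Phi_opp b : b \in Phi -> - b \in Phi.
Proof.
have [_ PhiE] := ccb_roots ccb.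
by move=> /PhiE rb; apply/PhiE; apply: (nonzero_weights_opp f_sym f_pos f_skew).
Qed.

Lemma Phi_neq0 b : b \in Phi -> b != 0.
Proof. by have [_ PhiE] := ccb_roots ccb; move=> /PhiE []. Qed.

Lemma Phip_Phi b : b \in Phip -> b \in Phi.
Proof. by rewrite mem_filter => /andP[]. Qed.

Lemma Delta_Phi a : a \in Delta -> a \in Phi.
Proof.
by have [_ PhiE] := ccb_roots ccb; move=> /(root_base_root base) /PhiE.
Qed.

Lemma nonneg_comb_anti (b : functional h) :
  nonneg_comb Delta b -> nonneg_comb Delta (- b) -> b = 0.
Proof.
move=> [n bE] [m NbE].
have nm0 : \sum_(i < size Delta) (n i + m i)%:R *: (in_tuple Delta)`_i = 0 :> functional h.
  rewrite -[RHS](subrr b) NbE {1}bE -big_split; apply: eq_bigr => i _ /=.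
  by rewrite scaler_nat mulrnDr.
have /freeP/(_ _ nm0) n0 : free (in_tuple Delta) by apply: root_base_free base.
rewrite bE big1 // => i _; have /eqP := n0 i.
by rewrite pnatr_eq0 addn_eq0 => /andP[/eqP-> _]; rewrite mulr0n.
Qed.

Lemma Phip_oppN b : b \in Phip -> - b \notin Phip.
Proof.
move=> bP; apply/negP => NbP; have /negP[] := Phi_neq0 (Phip_Phi bP).
move: bP NbP; rewrite !mem_filter => /andP[/asboolP b1 _] /andP[/asboolP b2 _].
exact/eqP/nonneg_comb_anti.
Qed.

Lemma size_Phip : (size Phip + size Phip <= size Phi)%N.
Proof.
have [uPhi _] := ccb_roots ccb.
have -> : (size Phip + size Phip = size (Phip ++ map -%R Phip))%N.
  by rewrite size_cat size_map.
apply: uniq_leq_size => [|b].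
  rewrite cat_uniq filter_uniq // map_inj_uniq ?filter_uniq ?andbT //=.
    by apply/hasPn => _ /mapP[b bP ->]; apply: Phip_oppN.
  exact: oppr_inj.
rewrite mem_cat => /orP[/Phip_Phi//|/mapP[c /Phip_Phi cP ->]].
exact: Phi_opp.
Qed.

(** A Chevalley basis has [#|Phi| + #|Delta|] elements, and a compact one
    [#|Delta| + 2 #|Phi+|], where [2 #|Phi+| <= #|Phi|] because [Phi = - Phi];
    hence a compact Chevalley basis spans [g0] with at most [dim g0] elements. *)
Lemma compact_chevalley_is_basis : basis_of fullv C0.
Proof.
rewrite basisEdim (ccb_span ccb) subvv /=.
have -> : size C0 = size [seq cinj x | x <- C0] by rewrite size_map.
rewrite (ccb_family ccb) !size_cat !size_map -dim_complexification.
rewrite (size_basis (X := in_tuple _) (chevalley_is_basis chev)).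
by rewrite size_cat !size_map addnC leq_add2r size_Phip.
Qed.

Lemma coroot_neq0 a : a \in Delta -> coroot brC a != 0.
Proof.
move=> aD; apply: free_not0 (basis_free (chevalley_is_basis chev)) _.
by rewrite mem_cat map_f ?orbT.
Qed.

(** [coroot a] belongs to a basis, so it is nonzero, so [root_vector a] is not
    the default value [0] but represents [a] for the Killing form. *)
Lemma root_vectorP a (b : functional h) : a \in Delta ->
  fval a (root_vector brC b) = killingC (root_vector brC b) (root_vector brC a).
Proof.
move=> /coroot_neq0; rewrite /coroot /root_vector.
case: xgetP => [T _ aT _|_]; last by rewrite [vsval 0]linear0 scaler0 eqxx.
by rewrite aT /fval vsvalK.
Qed.

Lemma coroot_mem (a : functional h) : coroot brC a \in h.
Proof. by rewrite memvZ // subvsP. Qed.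

Lemma compact_coroot_mem (a : functional h) : compact_coroot brC a \in h.
Proof. by rewrite memvZ // coroot_mem. Qed.

Lemma fval_coroot (a b : functional h) : b \in Delta ->
  killingC (root_vector brC a) (root_vector brC b) = 0 ->
  fval b (coroot brC a) = 0.
Proof. by move=> bD K0; rewrite fvalZ root_vectorP // K0 mulr0. Qed.

Lemma fval_coroot_self a : a \in Delta -> fval a (coroot brC a) = 2.
Proof.
move=> aD; rewrite fvalZ root_vectorP // divfK //.
by apply: contra (coroot_neq0 aD) => /eqP K0; rewrite /coroot K0 invr0 mulr0 scale0r.
Qed.

Lemma compact_corootP a : a \in Delta ->
  exists Z, [/\ Z \in C0, Z \in h0 & cinj Z = compact_coroot brC a].
Proof.
move=> aD; have : compact_coroot brC a \in [seq cinj x | x <- C0].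
  by rewrite (ccb_family ccb) mem_cat map_f.
case/mapP => Z ZC ZE; exists Z; split=> //.
have := compact_coroot_mem a; rewrite ZE.
by rewrite mem_complexify /= mem0v andbT.
Qed.

Lemma cartan_comb x : x \in h0 ->
  exists c : functional h -> R, cinj x = \sum_(a <- Delta) (c a)%:C%C *: compact_coroot brC a.
Proof. by move=> xh; apply/(ccb_cartan_span ccb). Qed.

Lemma brC_cartan z w : z \in h -> w \in h -> brC z w = 0.
Proof.
have [ab _] := ccb_maximal_abelian ccb.
rewrite !mem_complexify => /andP[z1 z2] /andP[w1 w2].
by congr Cplx; rewrite /= !ab ?subr0 ?addr0.
Qed.

Lemma weight0_cartan z : z \in h -> weight_space brC (0 : functional h) z.
Proof.
move=> zh; apply/weight_spaceP => w wh.
by rewrite brC_cartan // /fval zero_lfunE scale0r.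
Qed.

Lemma fC_sym z w : fC z w = fC w z.
Proof. exact: complexify_sym. Qed.

(** By invariance [(b + c)(H) <z, w> = 0] for every [H] in the Cartan
    subalgebra. *)
Lemma weight_spaces_orthogonal (b c : functional h) z w :
  weight_space brC b z -> weight_space brC c w -> b + c != 0 -> fC z w = 0.
Proof.
move=> /weight_spaceP bz /weight_spaceP cw bc.
apply/eqP; apply: contraNT bc => zw; apply/eqP/lfunP => H.
rewrite add_lfunE zero_lfunE; apply/eqP.
have Hh := subvsP H; have := complexify_skew f_skew (vsval H) z w.
rewrite bz // cw // linearZl_LR linearZr_LR /= => /eqP.
rewrite -addr_eq0 -scalerDl scaler_eq0 (negPf zw) orbF /fval vsvalK.
by [].
Qed.


Lemma root_space b : b \in Phi -> weight_space brC b (X b).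
Proof. by move=> bP; have := chevalley_root_space chev bP. Qed.

Lemma root_spaces_orthogonal b c : b \in Phi -> c \in Phi -> b + c != 0 ->
  fC (X b) (X c) = 0.
Proof. by move=> /root_space wb /root_space wc; apply: weight_spaces_orthogonal. Qed.

Lemma cartan_root_orthogonal z b : z \in h -> b \in Phi -> fC z (X b) = 0.
Proof.
move=> zh bP; apply: weight_spaces_orthogonal (weight0_cartan zh) (root_space bP) _.
by rewrite add0r Phi_neq0.
Qed.

(** With [tau_a] the coroots,
    [<tau_a, tau_b> = <tau_a, [X_b, X_-b]> = b(tau_a) <X_b, X_-b>]. *)
Lemma coroots_orthogonal a b : a \in Delta -> b \in Delta ->
  killingC (root_vector brC a) (root_vector brC b) = 0 ->
  fC (coroot brC a) (coroot brC b) = 0.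
Proof.
move=> aD bD K0; have bP := Delta_Phi bD.
rewrite -(chevalley_opp chev bP) -[LHS]opprK -(complexify_skew f_skew).
rewrite (complexify_alt br_alt) linearNl opprK.
move/weight_spaceP: (root_space bP) => ->; last exact: coroot_mem.
by rewrite fval_coroot // scale0r linear0l.
Qed.

Lemma Phip_add_neq0 b c : b \in Phip -> c \in Phip -> b + c != 0.
Proof.
move=> bP cP; apply: contraL cP => /eqP bc0.
have -> : c = - b by rewrite -[c](addKr b) bc0 addr0.
exact: Phip_oppN.
Qed.

Lemma root_pairs_orthogonal b c (k l m n : R[i]) : b \in Phip -> c \in Phip -> b != c ->
  fC (k *: X b + l *: X (- b)) (m *: X c + n *: X (- c)) = 0.
Proof.
move=> bP cP bc; have [bPhi cPhi] := (Phip_Phi bP, Phip_Phi cP).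
have [NbPhi NcPhi] := (Phi_opp bPhi, Phi_opp cPhi).
rewrite linearDl !linearDr !linearZl_LR !linearZr_LR /=.
rewrite !root_spaces_orthogonal ?scaler0 ?addr0 //.
- by rewrite -opprD oppr_eq0 Phip_add_neq0.
- by rewrite addrC subr_eq0 eq_sym.
- by rewrite subr_eq0.
- exact: Phip_add_neq0.
Qed.

Lemma root_pair_orthogonal b : b \in Phip ->
  fC (X b - X (- b)) ('i%C *: X b + 'i%C *: X (- b)) = 0.
Proof.
move=> bP; have bPhi := Phip_Phi bP; have NbPhi := Phi_opp bPhi.
rewrite linearBl !linearDr !linearZr_LR /= [fC (X (- b)) (X b)]fC_sym.
rewrite [fC (X b) (X b)]root_spaces_orthogonal ?Phip_add_neq0 //.
rewrite [fC (X (- b)) (X (- b))]root_spaces_orthogonal //.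
  by rewrite !scaler0 addr0 add0r subrr.
by rewrite -opprD oppr_eq0 Phip_add_neq0.
Qed.

Variant compact_family_spec z : Prop :=
  | CompactCoroot a of a \in Delta & z = compact_coroot brC a
  | CompactA b of b \in Phip & z = X b - X (- b)
  | CompactB b of b \in Phip & z = 'i%C *: X b + 'i%C *: X (- b).

Lemma compact_familyP x : x \in C0 -> compact_family_spec (cinj x).
Proof.
move=> /(map_f (@cinj R g0)); rewrite (ccb_family ccb) !mem_cat.
case/or3P => /mapP[a aP ->].
- exact: CompactCoroot aP erefl.
- exact: CompactA aP erefl.
- exact: CompactB aP erefl.
Qed.

Lemma compact_chevalley_orthogonal x y : x \in C0 -> y \in C0 -> x != y ->
  f x y = 0 \/ exists a b,
    [/\ a \in Delta /\ b \in Delta,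
        killingC (root_vector brC a) (root_vector brC b) != 0,
        cinj x = compact_coroot brC a & cinj y = compact_coroot brC b].
Proof.
move=> xC yC xy.
have fE : fC (cinj x) (cinj y) = 0 -> f x y = 0.
  by rewrite complexify_bilinear_cinj => /(congr1 (@creal _ _)).
have xyC : cinj x != cinj y by rewrite (inj_eq (@cinj_inj _ _)).
have AE b : X b - X (- b) = 1 *: X b + (-1) *: X (- b) by rewrite scale1r scaleN1r.
have tau_orth (a b : functional h) k l : b \in Phip ->
    fC (compact_coroot brC a) (k *: X b + l *: X (- b)) = 0.
  move=> /Phip_Phi bP; rewrite linearDr !linearZr_LR /=.
  rewrite !cartan_root_orthogonal ?compact_coroot_mem ?Phi_opp //.
  by rewrite !scaler0 addr0.
case: (compact_familyP xC) => [a aD xE|b bP xE|b bP xE];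
  case: (compact_familyP yC) => [a' aD' yE|b' bP' yE|b' bP' yE];
  rewrite {}xE {}yE in fE xyC *.
- have [K0|K0] := eqVneq (killingC (root_vector brC a) (root_vector brC a')) 0.
    left; apply: fE; rewrite linearZl_LR linearZr_LR /= coroots_orthogonal //.
    by rewrite !scaler0.
  by right; exists a, a'.
- by left; apply: fE; rewrite AE tau_orth.
- by left; apply: fE; rewrite tau_orth.
- by left; apply: fE; rewrite fC_sym AE tau_orth.
- left; apply: fE; have bb : b != b' by apply: contra xyC => /eqP->.
  by rewrite !AE root_pairs_orthogonal.
- left; apply: fE; have [<-|bb] := eqVneq b b'; first exact: root_pair_orthogonal.
  by rewrite AE root_pairs_orthogonal.
- by left; apply: fE; rewrite fC_sym tau_orth.
- left; apply: fE; rewrite fC_sym; have [<-|bb] := eqVneq b b'.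
    exact: root_pair_orthogonal.
  by rewrite AE root_pairs_orthogonal // eq_sym.
- left; apply: fE; have bb : b != b' by apply: contra xyC => /eqP->.
  by rewrite root_pairs_orthogonal.
Qed.

Section Module.
Variables (U : vectType R) (act : {bilinear g0 -> U -> U}).
Hypothesis mod : lie_module br act.
Notation actC := (complexify_bilinear act).

(** [X_a], [X_-a] and [coroot a] span a copy of sl_2. *)
Lemma weight_coroot_integral a (lam : functional h) v :
  a \in Delta -> weight_space actC lam v -> v != 0 ->
  exists m : int, fval lam (coroot brC a) = m%:~R.
Proof.
move=> aD /weight_spaceP wv v0; have aP := Delta_Phi aD.
have modC := complexify_lie_module mod.
have root_act b u : b \in Phi -> actC (coroot brC a) (actC (X b) u) =
    actC (X b) (actC (coroot brC a) u) + fval b (coroot brC a) *: actC (X b) u.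
  move=> bP; apply/eqP; rewrite addrC -subr_eq -modC; apply/eqP.
  move/weight_spaceP: (root_space bP) => ->; last exact: coroot_mem.
  by rewrite linearZl_LR.
pose T : {bilinear complexification g0 -> complexification U -> complexification U} :=
  actC.
apply: (@sl2_eigenvalue_integral _ _ (T (X a)) (T (X (- a))) (T (coroot brC a)) _ v)
  => // [u|u|u|]; rewrite /T /=.
- by rewrite root_act // fval_coroot_self.
- rewrite root_act ?Phi_opp // -[fval _ _]opprK.
  have -> : - fval (- a) (coroot brC a) = 2.
    by rewrite -(fval_coroot_self aD) /fval opp_lfunE opprK.
  by rewrite scaleNr.
- by apply/eqP; rewrite addrC -subr_eq -modC (chevalley_opp chev aP).
- by rewrite wv ?coroot_mem.
Qed.

(** The compact coroots span [h0] over the reals, hence [h] over the complex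
    numbers. *)
Lemma weight_space_coroots (lam : functional h) v :
  {in Delta, forall a, actC (compact_coroot brC a) v =
    fval lam (compact_coroot brC a) *: v} ->
  weight_space actC lam v.
Proof.
move=> wv; apply: weight_space_real => x /cartan_comb[c ->].
rewrite linear_sumlz [fval _ _]linear_sum scaler_suml big_seq [RHS]big_seq.
apply: eq_bigr => a aD; by rewrite linearZl_LR /= wv // scalerA -fvalZ.
Qed.

(** If [lam] vanished at all the coroots, [v] would also have weight [0]. *)
Lemma nonzero_weight_coroot (lam : functional h) v :
  lam != 0 -> v != 0 -> weight_space actC lam v ->
  exists2 a, a \in Delta & fval lam (coroot brC a) != 0.
Proof.
move=> lam0 v0 /weight_spaceP wv; apply/hasP; apply: contraNT lam0.
move=> /hasPn lamD; apply/eqP/lfunP => H; apply/eqP.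
have /weight_spaceP w0 : weight_space actC (0 : functional h) v.
  apply: weight_space_coroots => a aD; rewrite wv ?compact_coroot_mem //.
  by rewrite fvalZ (eqP (negbNE (lamD a aD))) mulr0 /fval zero_lfunE.
have := w0 _ (subvsP H); rewrite (wv _ (subvsP H)) /fval vsvalK zero_lfunE scale0r.
by move/eqP; rewrite scaler_eq0 (negPf v0) orbF.
Qed.

(** A compact coroot lies in the real form, so taking its real part loses
    nothing. *)
Definition real_coroot (a : functional h) : g0 := creal (compact_coroot brC a).

Lemma cinj_real_coroot a : a \in Delta ->
  cinj (real_coroot a) = compact_coroot brC a.
Proof. by move=> /compact_corootP[Z [_ _ ZE]]; rewrite /real_coroot -ZE. Qed.

Lemma real_coroot_C0 a : a \in Delta -> real_coroot a \in C0.
Proof. by move=> /compact_corootP[Z [ZC _ ZE]]; rewrite /real_coroot -ZE. Qed.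

Lemma act_real_coroot_comm a b u : a \in Delta -> b \in Delta ->
  act (real_coroot a) (act (real_coroot b) u) =
  act (real_coroot b) (act (real_coroot a) u).
Proof.
move=> /compact_corootP[Z [_ Zh ZE]] /compact_corootP[Z' [_ Zh' ZE']].
rewrite /real_coroot -ZE -ZE' /=; apply/eqP; rewrite -subr_eq0 -mod.
by have [ab _] := ccb_maximal_abelian ccb; rewrite ab // linear0l.
Qed.

Lemma actC_compact_coroot a v : a \in Delta -> actC (compact_coroot brC a) v =
  Cplx (act (real_coroot a) (creal v)) (act (real_coroot a) (cimag v)).
Proof. by move=> aD; rewrite -cinj_real_coroot // complexify_bilinear_cinj. Qed.

Lemma real_zero_weight_spaceP u : real_zero_weight_space act h0 u <->
  {in Delta, forall a, act (real_coroot a) u = 0}.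
Proof.
split=> [/weight_spaceP w0 a aD|u0].
  apply: cinj_inj; have := w0 _ (compact_coroot_mem a).
  rewrite /fval zero_lfunE scale0r actC_compact_coroot //= => -[-> _].
  by [].
apply: weight_space_coroots => a aD; rewrite /fval zero_lfunE scale0r.
by rewrite actC_compact_coroot //= u0 // linear0r.
Qed.

(** A vector of [U_lam] is [v + w] with [v] and [w] of weights [lam] and
    [- lam], so [tau_a tau_b], where [tau_a] acts by [i m_a] on [v] and [- i m_a]
    on [w], acts by [- m_a m_b].  Conversely these quadratic equations, with
    [m_a <> 0], make [v = (u - i tau_a u / m_a) / 2] a weight vector. *)
Lemma real_weight_spaceP (lam : functional h) (m : functional h -> R) u :
    {in Delta, forall a, fval lam (coroot brC a) = (m a)%:C%C} ->
    (exists2 a, a \in Delta & m a != 0) ->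
  real_weight_space act lam u <->
  {in Delta &, forall a b,
    act (real_coroot a) (act (real_coroot b) u) = - (m a * m b) *: u}.
Proof.
move=> lamE [a0 a0D m0].
have lamE' a : a \in Delta -> fval lam (compact_coroot brC a) = Complex 0 (m a).
  by move=> aD; rewrite fvalZ lamE //; simpc.
split=> [[v [w [/weight_spaceP wv /weight_spaceP ww uE]]] a b aD bD|uE].
  have tau_h := compact_coroot_mem.
  have fvalN z : fval (- lam) z = - fval lam z by rewrite /fval opp_lfunE.
  apply: cinj_inj; rewrite cinjZ uE.
  have -> : cinj (act (real_coroot a) (act (real_coroot b) u)) =
      actC (compact_coroot brC a) (actC (compact_coroot brC b) (cinj u)).
    by rewrite !actC_compact_coroot //= !linear0r.
  rewrite uE !linearDr /= (wv _ (tau_h b)) (ww _ (tau_h b)).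
  rewrite 2!linearZr_LR /= (wv _ (tau_h a)) (ww _ (tau_h a)).
  rewrite !scalerA !fvalN mulrNN -scalerDr !lamE' //; congr (_ *: _).
  by simpc; rewrite mulrC.
pose t := act (real_coroot a0) u.
(* Since [tau_a0 tau_a0] is the nonzero scalar [- m_a0 ^ 2] on [u], applying
   [tau_a0] to [tau_a0 tau_b u = - m_a0 m_b u] gives [tau_b u]. *)
have tE b : b \in Delta -> act (real_coroot b) u = (m b / m a0) *: t.
  move=> bD; have := uE _ _ a0D bD; rewrite act_real_coroot_comm // -/t => tbE.
  have := congr1 (act (real_coroot a0)) tbE.
  rewrite act_real_coroot_comm // uE // !linearZr_LR /= -/t => /eqP.
  rewrite !scaleNr eqr_opp => /eqP E.
  have mm : m a0 * m a0 != 0 by rewrite mulf_neq0.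
  by apply: (scalerI mm); rewrite E scalerA; congr (_ *: _); field.
have tbE b : b \in Delta -> act (real_coroot b) t = - (m b * m a0) *: u.
  by move=> bD; rewrite uE.
(* [e = 1] gives the component of weight [lam], [e = -1] that of [- lam]. *)
have half_weight (e : R) : e ^+ 2 = 1 ->
  {in Delta, forall b,
    actC (compact_coroot brC b) (Cplx (2^-1 *: u) (- (e / (2 * m a0)) *: t)) =
    (Complex 0 (e * m b)) *: Cplx (2^-1 *: u) (- (e / (2 * m a0)) *: t)}.
  move=> e2 b bD; rewrite actC_compact_coroot //=; congr Cplx; rewrite /= !linearZr_LR /=.
    rewrite tE // !scale0r sub0r !scalerA -scaleNr; congr (_ *: _).
    transitivity (e ^+ 2 * (2^-1 * (m b / m a0))); first by rewrite e2 mul1r.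
    by field.
  rewrite tbE // scale0r add0r !scalerA; congr (_ *: _).
  by field.
exists (Cplx (2^-1 *: u) (- (1 / (2 * m a0)) *: t)).
exists (Cplx (2^-1 *: u) (- (- 1 / (2 * m a0)) *: t)).
split.
- apply: weight_space_coroots => b bD; rewrite half_weight ?expr1n //.
  by rewrite lamE' // [1 * m b]mul1r.
- apply: weight_space_coroots => b bD; rewrite half_weight ?sqrrN ?expr1n //.
  by rewrite /fval opp_lfunE -/(fval _ _) lamE' // [-1 * m b]mulN1r; simpc.
- congr Cplx => /=.
    by rewrite -scalerDl -[LHS]scale1r; congr (_ *: _); field.
  by rewrite -scalerDl mulNr opprK addNr scale0r.
Qed.

End Module.

End CompactChevalley.

(** * Two-step nilpotent algebras *)

Section Nilpotent.
Variables (R : realType) (U g0 : vectType R).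
Notation n0 := (U * g0)%type.

Lemma inU_is_linear : linear (inU g0 : U -> n0).
Proof. by move=> a u v; congr pair; rewrite /= scaler0 addr0. Qed.
HB.instance Definition _ :=
  GRing.isLinear.Build R U n0 _ (inU g0 : U -> n0) inU_is_linear.

Lemma inG_is_linear : linear (inG U : g0 -> n0).
Proof. by move=> a Y Z; congr pair; rewrite /= scaler0 addr0. Qed.
HB.instance Definition _ :=
  GRing.isLinear.Build R g0 n0 _ (inG U : g0 -> n0) inG_is_linear.

Lemma span_map (E F : vectType R) (j : {linear E -> F}) s w :
  w \in <<s>>%VS -> j w \in <<[seq j x | x <- s]>>%VS.
Proof.
move=> sw; rewrite (coord_span (X := in_tuple s) sw) linear_sum.
apply: memv_suml => i _; rewrite linearZ memvZ // memv_span // map_f //.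
exact: mem_nth.
Qed.

Lemma union_basis_is_basis (B : seq U) (C : seq g0) :
  basis_of fullv B -> basis_of fullv C -> basis_of fullv (union_basis B C).
Proof.
move=> basB basC; rewrite basisEdim; apply/andP; split.
  apply/subvP => -[u Z] _.
  have -> : (u, Z) = inU g0 u + inG U Z by congr pair; rewrite /= ?addr0 ?add0r.
  by rewrite span_cat memv_add // span_map // ?(span_basis basB) ?(span_basis basC) memvf.
rewrite size_cat !size_map -[size B](size_basis (X := in_tuple B) basB).
by rewrite -[size C](size_basis (X := in_tuple C) basC) !dimvf.
Qed.

Lemma union_basis_U (B : seq U) (C : seq g0) u :
  u \in B -> inU g0 u \in union_basis B C.
Proof. by move=> Bu; rewrite mem_cat map_f. Qed.

Lemma union_basis_G (B : seq U) (C : seq g0) Z :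
  Z \in C -> inG U Z \in union_basis B C.
Proof. by move=> CZ; rewrite mem_cat map_f ?orbT. Qed.

Lemma rat_span_inU (B : seq U) (C : seq g0) u :
  rat_span B u -> rat_span (union_basis B C) (inU g0 u).
Proof.
move=> /(rat_span_map (inU g0)); apply: rat_span_trans => _ /mapP[v Bv ->].
exact/rat_span_mem/union_basis_U.
Qed.

Lemma rat_span_fst (B : seq U) (C : seq g0) w :
  rat_span (union_basis B C) w -> rat_span B w.1.
Proof.
move=> /(rat_span_map fst); apply: rat_span_trans => _ /mapP[x + ->].
rewrite mem_cat => /orP[] /mapP[v Bv ->] /=; last exact: rat_span0.
exact: rat_span_mem.
Qed.

(** [U] is rational, having the basis [B], and each rational operator cuts it
    down to a rational subspace. *)
Lemma rational_subspace_common_kernel (B : seq U) (C : seq g0) (I : eqType) (r : seq I)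
    (T : I -> U -> U) :
    basis_of fullv B -> basis_of fullv C -> (forall i, linear (T i)) ->
    (forall i u, i \in r -> rat_span B u -> rat_span B (T i u)) ->
  rational_subspace (rat_span (union_basis B C))
    [set x | exists2 u, {in r, forall i, T i u = 0} & x = inU g0 u].
Proof.
move=> basB basC Tlin TQ.
pose T' i : {linear U -> U} := HB.pack (T i) (GRing.isLinear.Build _ _ _ _ (T i) (Tlin i)).
pose T1 i : {linear n0 -> U} := T' i \o fst.
have ratU : rational_subspace (rat_span (union_basis B C)) [set x | exists u, x = inU g0 u].
  exists (map (inU g0) B); split.
  - exact: catl_free (basis_free (union_basis_is_basis basB basC)).
  - by move=> _ /mapP[u Bu ->]; apply/rat_span_mem/union_basis_U.
  move=> w; split=> [sw|[u ->]]; last by rewrite span_map // (span_basis basB) memvf.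
  have fB := catl_free (basis_free (union_basis_is_basis basB basC)).
  exists w.1; have [c -> _] := free_span fB sw.
  rewrite big_map; transitivity (inU g0 (\sum_(u <- B) c (inU g0 u) *: u)).
    by rewrite linear_sum; apply: eq_bigr => u _; rewrite linearZ.
  by congr (inU g0 _); rewrite raddf_sum.
have := rational_subspace_kernels (r := r) (T := T1) basB _ ratU.
move=> /(_ (fun i w ri Qw => TQ i _ ri (rat_span_fst Qw))).
congr rational_subspace; apply/seteqP; split=> w /=.
  by move=> [[u ->] Tu]; exists u.
by move=> [u Tu ->]; split=> //; exists u.
Qed.

Variables (ip : {dot n0 for idfun}).

(** The values are taken in [R^o], a vector space, so that the form can be
    complexified in the same way as the bracket. *)
Definition ipG (Y Z : g0) : R^o := ip (inG U Y) (inG U Z).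

Lemma ipG_is_bilinear : bilinear_for *:%R *:%R ipG.
Proof.
split=> [Z a Y Y'|Y a Z Z']; rewrite /ipG linearP.
  by rewrite linearDl linearZl_LR.
by rewrite linearDr linearZr_LR.
Qed.
HB.instance Definition _ :=
  bilinear_isBilinear.Build R g0 g0 R^o *:%R *:%R ipG ipG_is_bilinear.

Lemma ipG_sym Y Z : ipG Y Z = ipG Z Y.
Proof. exact: ip_sym. Qed.

Lemma ipG_pos Z : Z != 0 -> 0 < (ipG Z Z : R).
Proof. by move=> Z0; apply: neq0_dnorm_gt0; apply: contra Z0 => /eqP[->]. Qed.

Variables (act : {bilinear g0 -> U -> U}).
Variables (B0 : seq U) (C0 : seq g0).
Hypothesis basC : basis_of fullv C0.
Hypothesis adm : admissible_basis act ip C0 B0.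

Let L0 := union_basis B0 C0.
Let basB : basis_of fullv B0 := adm_basis adm.

Lemma ip_rational v w : rat_span L0 v -> rat_span L0 w -> rational (ip v w).
Proof. by apply: rational_ip => x y xL yL; apply: (adm_rational adm). Qed.

(** For [u, u'] in [B0] the products [<[u, u'], Z> = <Z u, u'>] with [Z] in
    [C0] are rational, and so are the inner products inside [C0]. *)
Lemma nilpotent_rational_structure (brn : {bilinear n0 -> n0 -> n0}) :
  nilpotent_bracket act ip brn -> rational_structure_constants brn L0.
Proof.
move=> nilp i j k; apply: rat_span_coord.
  exact: basis_free (union_basis_is_basis basB basC).
have brnC x y : brn x y = - brn y x by apply: alternating_antisym (nilp_lie nilp).1 _ _.
move: (L0`_i) (L0`_j) (mem_nth 0 (ltn_ord i)) (mem_nth 0 (ltn_ord j)) => x y.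
rewrite mem_cat => /orP[] /mapP[u uP ->]; last first.
  by move=> _; rewrite (nilp_central nilp); apply: rat_span0.
rewrite mem_cat => /orP[] /mapP[u' uP' ->]; last first.
  by rewrite brnC (nilp_central nilp) oppr0; apply: rat_span0.
have [Z ZE] := nilp_derived nilp (inU g0 u) (inU g0 u'); rewrite ZE.
apply: (@rat_span_trans _ _ (map (inG U) C0)).
  by move=> _ /mapP[c cC ->]; apply/rat_span_mem/union_basis_G.
apply: (rat_span_pairing (ip := ip)).
- exact: catr_free (basis_free (union_basis_is_basis basB basC)).
- by move=> _ _ /mapP[c cC ->] /mapP[c' cC' ->]; apply: (adm_rational adm);
    apply: union_basis_G.
- by rewrite span_map // (span_basis basC) memvf.
move=> _ /mapP[c cC ->]; rewrite ip_sym -ZE (nilp_ip nilp).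
apply: ip_rational; apply: rat_span_inU; last exact: rat_span_mem.
by apply: (adm_invariant adm) => //; apply: rat_span_mem.
Qed.

(** Gram-Schmidt applied to [B0] keeps its rational span, which is all that
    invariance and rationality depend on. *)
Lemma orthogonal_admissible_basis : exists2 B1, admissible_basis act ip C0 B1 &
  {in B1 &, forall u v, u != v -> ip (inU g0 u) (inU g0 v) = 0}.
Proof.
have fB : free (map (inU g0) B0) by apply: catl_free (basis_free (union_basis_is_basis basB basC)).
have [|t [ft szt ot tB Bt]] := rational_Gram_Schmidt (ip := ip) fB.
  by move=> _ _ /mapP[u uB ->] /mapP[v vB ->]; apply: (adm_rational adm);
    apply: union_basis_U.
have fstB : map fst (map (inU g0) B0) = B0 by rewrite -map_comp map_id.
(* The orthogonal basis stays inside [U]. *)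
have tE x : x \in t -> x = inU g0 x.1.
  move=> /tB; apply: (@rat_span_rect _ _ _ (fun x => x = inU g0 x.1)) => //.
  - by move=> v w -> ->; congr pair; rewrite /= addr0.
  - by move=> a _ _ /mapP[u _ ->]; congr pair; rewrite /= scaler0.
have B1Q v : rat_span (map fst t) v -> rat_span B0 v.
  apply: rat_span_trans => _ /mapP[x /tB/(rat_span_map fst) + ->].
  by rewrite fstB.
have BQ1 v : rat_span B0 v -> rat_span (map fst t) v.
  apply: rat_span_trans => u uB.
  by have /(rat_span_map fst) := Bt _ (map_f (inU g0) uB).
exists (map fst t).
  split.
  - rewrite basisEdim -{1}(span_basis basB) span_rat_span; last first.
      by move=> u uB; apply/BQ1/rat_span_mem.
    by rewrite /= size_map szt size_map (size_basis (X := in_tuple B0) basB) leqnn.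
  - by move=> Z v ZC /B1Q Qv; apply/BQ1/(adm_invariant adm).
  - have L1Q x : x \in union_basis (map fst t) C0 -> rat_span L0 x.
      rewrite mem_cat => /orP[] /mapP[u uB ->].
        by apply: rat_span_inU; apply/B1Q/rat_span_mem.
      exact/rat_span_mem/union_basis_G.
    by move=> x y /L1Q Qx /L1Q Qy; apply: ip_rational.
move=> _ _ /mapP[x xt ->] /mapP[y yt ->] xy; rewrite -!tE // ot //.
by apply: contra xy => /eqP->.
Qed.

End Nilpotent.

Theorem proposition8p2 (R : realType) (g0 U : vectType R)
    (br : {bilinear g0 -> g0 -> g0}) (act : {bilinear g0 -> U -> U})
    (h0 : {vspace g0}) (Phi Delta : seq (functional (complexify_vspace h0)))
    (X : functional (complexify_vspace h0) -> complexification g0)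
    (C0 : seq g0) (B0 : seq U)
    (ip : {dot (U * g0)%type for idfun})
    (brn : {bilinear (U * g0)%type -> (U * g0)%type -> (U * g0)%type})
    (LamP : set (functional (complexify_vspace h0))) :
  lie_bracket br -> compact_semisimple br -> lie_module br act ->
  compact_chevalley_basis br Phi Delta X C0 ->
  invariant_inner_product br act ip ->
  admissible_basis act ip C0 B0 ->
  nilpotent_bracket act ip brn ->
  positive_weights act LamP ->
  let L0 := union_basis B0 C0 in
  [/\ basis_of fullv L0,
      rational_structure_constants brn L0,
      exists2 B1, admissible_basis act ip C0 B1 &
        orthogonal_up_to_coroots br ip Delta (union_basis B1 C0),
      rational_subspace (rat_span L0)
        [set x | exists2 u, real_zero_weight_space act h0 u & x = inU g0 u] &
      forall lam, LamP lam ->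
        rational_subspace (rat_span L0)
          [set x | exists2 u, real_weight_space act lam u & x = inU g0 u]].
Proof.
move=> [br_alt _] _ mod ccb inv adm nilp [LamW _] L0.
have f_sym := ipG_sym ip; have f_pos := @ipG_pos _ _ _ ip.
have f_skew : forall Z Y Y', ipG ip (br Z Y) Y' = - ipG ip Y (br Z Y').
  by move=> Z Y Y'; apply: ip_ad_skew inv _ _ _.
have basB := adm_basis adm.
have basC : basis_of fullv C0 := compact_chevalley_is_basis ccb f_sym f_pos f_skew.
have actQ a u : a \in Delta -> rat_span B0 u ->
    rat_span B0 (act (real_coroot br a) u).
  by move=> /(real_coroot_C0 ccb) aC Qu; apply: (adm_invariant adm).
split.
- exact: union_basis_is_basis.
- by have := nilpotent_rational_structure basC adm nilp.
- have [B1 admB1 oB1] := orthogonal_admissible_basis basC adm.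
  exists B1 => // brC x y; rewrite !mem_cat.
  case/orP=> /mapP[u uP ->] /orP[] /mapP[v vP ->] xy.
  + by left; apply: oB1 => //; apply: contra xy => /eqP->.
  + by left; apply: ip_orthogonal inv _ _.
  + by left; rewrite ip_sym; apply: ip_orthogonal inv _ _.
  + have uv : u != v by apply: contra xy => /eqP->.
    have [|[a [b [abD K0 uE vE]]]] :=
      compact_chevalley_orthogonal br_alt ccb f_sym f_pos f_skew uP vP uv; first by left.
    by right; exists a, b, u, v; split.
- have := rational_subspace_common_kernel (r := Delta) (T := fun a => act (real_coroot br a))
    basB basC _ actQ.
  move=> /(_ (fun a => linearP (act (real_coroot br a)))).
  congr rational_subspace; apply/seteqP; split=> _ [u uP ->]; exists u => //.
    exact/(real_zero_weight_spaceP ccb).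
  exact/(real_zero_weight_spaceP ccb).
move=> lam /LamW [lam0 [v v0 wv]].
have integral := weight_coroot_integral ccb f_sym f_pos f_skew mod _ wv v0.
pose m (a : functional (complexify_vspace h0)) : R :=
  complex.Re (fval lam (coroot (complexify_bilinear br) a)).
have mE : {in Delta, forall a,
    fval lam (coroot (complexify_bilinear br) a) = (m a)%:C%C /\ rational (m a)}.
  move=> a /integral[n nE]; rewrite /m nE -(rmorph_int (real_complex R)) /=.
  by split=> //; apply: rational_int.
have [a0 a0D a0n] := nonzero_weight_coroot ccb lam0 v0 wv.
have weightP u : real_weight_space act lam u <->
    {in Delta &, forall a b, act (real_coroot br a) (act (real_coroot br b) u) =
      - (m a * m b) *: u}.
  apply: (real_weight_spaceP ccb mod) => [a /mE[]//|].
  by exists a0 => //; apply: contra a0n => /eqP m0; rewrite (mE _ a0D).1 m0.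
pose T (p : functional (complexify_vspace h0) * functional (complexify_vspace h0)) u :=
  act (real_coroot br p.1) (act (real_coroot br p.2) u) + (m p.1 * m p.2) *: u.
pose pairs := [seq (a, b) | a <- Delta, b <- Delta].
have := rational_subspace_common_kernel (r := pairs) (T := T) basB basC.
case.
- move=> p c u w; rewrite /T !linearPr /= !scalerDr !scalerA [c * _]mulrC.
  by rewrite !addrA; congr (_ + _); rewrite -!addrA; congr (_ + _); rewrite addrC.
- move=> p u /allpairsP[[a b] [/= aD bD ->]] Qu; apply: rat_spanD => /=.
    by apply: (actQ _ _ aD); apply: actQ.
  by apply: rat_spanZ => //; apply: rationalM; apply: (mE _ _).2.
move=> s sP; exists s; case: sP => fs sQ sE; split=> // w.
split=> [/sE[u uP ->]|[u /weightP uP ->]].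
  exists u => //; apply/weightP => a b aD bD; apply/eqP.
  rewrite scaleNr -addr_eq0; apply/eqP; apply: (uP (a, b)).
  by apply/allpairsP; exists (a, b).
apply/sE; exists u => // _ /allpairsP[[a b] [/= aD bD ->]].
by rewrite /T /= uP // scaleNr addNr.
Qed.
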